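(* Let $\eta$ be a stationary hyperuniform point process on $\mathbb{R}$ (unit intensity) with truncated pair correlation measure $\beta$ satisfying $|\beta|(\mathbb{R})<\infty$. Let $F(x)=\beta([x,\infty))$ and $G(y)=-\int_0^yF(x)\,\mathrm{d}x$. Then $G(y)=\frac12\operatorname{Var}(\eta(\Lambda_y))$ for all $y>0$. Consider the statements: (i) $G$ is regularly varying with some parameter $a\in[0,1]$, i.e. $\lim_{n\to\infty}G(xn)/G(n)=x^a$ for all $x>0$; (ii) for all $z\in\mathbb{R}$ the limit $\mathrm{cov}(z)$ exists and equals $\mathrm{cov}(z)=\frac{|z-1|^a}{2}+\frac{|z+1|^a}{2}-|z|^a$ if $a\in(0,1]$, while for $a=0$ one has $\mathrm{cov}(0)=1$, $\mathrm{cov}(1)=\mathrm{cov}(-1)=-\frac12$ and $\mathrm{cov}(z)=0$ for $z\notin\{-1,0,1\}$; (iii) the limits $\mathrm{cov}(1)$ and $\mathrm{cov}(2)$ exist and are finite. Then (i) implies (ii) (with the same $a$). If in addition $F(x)\le 0$ for all sufficiently large $x$ (or $F(x)\ge0$ for all sufficiently large $x$), then (i), (ii) and (iii) are all equivalent (with (iii) implying (i) for some $a\in[0,1]$). In each of these cases $\mathrm{cov}(1)=2^{a-1}-1$.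
   Context: A point process on $\mathbb{R}$ is a random simple locally finite counting measure; stationary means shift-invariant in law; unit intensity means $\mathbb{E}[\eta(W)]=\lambda_1(W)$. With $\alpha^2$ the second factorial moment measure $\alpha^2(W)=\mathbb{E}[\sum_{n_1\ne n_2}\mathbf 1_{(X_{n_1},X_{n_2})\in W}]$ for $\eta=\sum_n\delta_{X_n}$, the reduced measure $\alpha^2_!$ is defined by $\int f\,\mathrm{d}\alpha^2=\iint f(x+y,y)\,\alpha^2_!(\mathrm{d}x)\,\mathrm{d}y$ for measurable $f\ge0$, and the truncated pair correlation measure is the signed measure $\beta=\alpha^2_!-\lambda_1$; it is symmetric under $x\mapsto -x$. $\Lambda_n(z)=[z,z+n]$, $\Lambda_n=[0,n]$. Hyperuniform: $\operatorname{Var}(\eta(\Lambda_n))/n\to0$; under $|\beta|(\mathbb{R})<\infty$ this is equivalent to $\beta(\mathbb{R})=-1$. $\mathrm{cov}(z)=\lim_{n\to\infty}\operatorname{Cov}(\eta(\Lambda_n),\eta(\Lambda_n(nz)))/\operatorname{Var}(\eta(\Lambda_n))$. *)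

(* Defs.v *)
From HB Require Import structures.
From mathcomp Require Import all_boot all_order all_algebra.
From mathcomp Require Import all_classical all_reals all_analysis.
From mathcomp Require Import measurable_realfun.

Set Implicit Arguments.
Unset Strict Implicit.
Unset Printing Implicit Defensive.

Import Order.TTheory GRing.Theory Num.Theory.
Import numFieldNormedType.Exports.

Local Open Scope classical_set_scope.
Local Open Scope ring_scope.

Section point_processes.
Context {R : realType}.

(* A simple locally finite counting measure on R is identified with its
   support, a locally finite set of points S; S(W) = number of points of S in W
   (+oo if infinitely many). *)
Definition npts (S : set R) (W : set R) : \bar R := counting (S `&` W).

Definition locally_finite (S : set R) : Prop :=
  forall a b : R, finite_set (S `&` `[a, b]).

Definition Lam (z len : R) : set R := `[z, z + len].

Definition shift_set (W : set R) (z : R) : set R := [set x + z | x in W].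

Context {d : measure_display} {T : measurableType d} (P : probability T R).

Definition point_process (eta : T -> set R) : Prop :=
  (forall w, locally_finite (eta w)) /\
  (forall W : set R, measurable W ->
     measurable_fun [set: T] ((fun w => npts (eta w) W) : T -> \bar R)).

(* stationarity: the law of eta is shift invariant, i.e. all finite
   dimensional distributions are invariant under translation *)
Definition stationary (eta : T -> set R) : Prop :=
  forall (z : R) (n : nat) (B : 'I_n -> set R) (k : 'I_n -> nat),
    (forall i, measurable (B i)) ->
    P [set w | forall i, npts (eta w) (shift_set (B i) z) = (k i)%:R%:E]
    = P [set w | forall i, npts (eta w) (B i) = (k i)%:R%:E].

Definition unit_intensity (eta : T -> set R) : Prop :=
  forall W : set R, measurable W ->
    (\int[P]_w npts (eta w) W = (@lebesgue_measure R) W)%E.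

Definition distinct_pairs (S : set R) : set (R * R) :=
  [set p | S p.1 /\ S p.2 /\ p.1 <> p.2].

Definition alpha2 (eta : T -> set R) (W : set (R * R)) : \bar R :=
  (\int[P]_w counting (distinct_pairs (eta w) `&` W))%E.

(* ar is the reduced second factorial moment measure alpha^2_! :
   int f d alpha^2 = int int f(x+y,y) alpha^2_!(dx) dy, written for f = 1_W *)
Definition reduced_second_moment (eta : T -> set R)
    (ar : {measure set R -> \bar R}) : Prop :=
  forall W : set (R * R), measurable W ->
    alpha2 eta W =
    (\int[(@lebesgue_measure R)]_y \int[ar]_x (\1_W (x + y, y))%:E)%E.

(* the real-valued count eta(W) (finite for bounded W) *)
Definition cnt (eta : T -> set R) (W : set R) : T -> R :=
  fun w => fine (npts (eta w) W).

Definition hyperuniform (eta : T -> set R) : Prop :=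
  (fun n : nat => fine ('V_P[cnt eta (Lam 0 n%:R)]%E) / n%:R) @ \oo --> 0.

Definition cov_ratio (eta : T -> set R) (z : R) (n : nat) : R :=
  fine (covariance P (cnt eta (Lam 0 n%:R)) (cnt eta (Lam (n%:R * z) n%:R)))
  / fine ('V_P[cnt eta (Lam 0 n%:R)]%E).

(* "the limit cov(z) exists and equals l": the ratio is eventually defined
   (nonzero variance) and converges to l *)
Definition cov_limit (eta : T -> set R) (z l : R) : Prop :=
  (\forall n \near \oo, fine ('V_P[cnt eta (Lam 0 n%:R)]%E) != 0) /\
  cov_ratio eta z @ \oo --> l.

End point_processes.

Section functions.
Context {R : realType}.

(* beta is the truncated pair correlation measure alpha^2_! - lambda_1, as a
   finite signed measure (so |beta|(R) < oo) *)
Definition truncated_pair_correlation (ar : {measure set R -> \bar R})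
    (beta : {charge set R -> \bar R}) : Prop :=
  forall A : set R, measurable A -> (exists a b : R, A `<=` `[a, b]) ->
    beta A = (ar A - (@lebesgue_measure R) A)%E.

Definition Ffun (beta : {charge set R -> \bar R}) (x : R) : R :=
  fine (beta [set t | x <= t]).

Definition Gfun (beta : {charge set R -> \bar R}) (y : R) : R :=
  - Rintegral (@lebesgue_measure R) `[0, y] (Ffun beta).

Definition regularly_varying (G : R -> R) (a : R) : Prop :=
  (\forall n \near \oo, G n%:R != 0) /\
  forall x : R, 0 < x -> (fun n : nat => G (x * n%:R) / G n%:R) @ \oo --> x `^ a.

Definition cov_profile (a z : R) : R :=
  if a == 0 then
    (if z == 0 then 1 else if (z == 1) || (z == -1) then - (1 / 2) else 0)
  else `|z - 1| `^ a / 2 + `|z + 1| `^ a / 2 - `|z| `^ a.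

End functions.

(* Main.v *)
(** The covariance structure is determined by [G] alone.  Computing [E[eta(A) eta(B)]] with the
    reduced second moment measure gives, with [Phi x] the signed integral of [F] from [0] to [x],
    [Var(eta [0, y]) = y - Phi (- y) - Phi y].  Exchanging [A] and [B] shows that the odd part
    [Phi x - Phi (- x)] is additive, hence linear, and hyperuniformity forces its slope to be [-1];
    this gives [Var(eta [0, y]) = 2 G y] and
    [Cov(eta [0, n], eta [m, m + n]) = G |m + n| + G |m - n| - 2 G |m|],
    from which (i) => (ii) is immediate.

    Conversely (iii) says that [G(2n)/G(n)] and [G(3n)/G(n)] converge.  Counts being integers,
    [Var(eta [0, n + 1/2]) >= 1/4], so [G] stays away from [0] when it is eventually monotone.
    If it is eventually nonincreasing it has a positive limit and is regularly varying of index
    [0].  If it is eventually nondecreasing, the logarithms of the dilations along which [G]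
    has a limit ratio form a subgroup containing the incommensurable numbers [ln 2] and [ln 3];
    it is dense, and monotonicity gives regular variation.  The index is at most [1] because
    [G(n)/n] tends to [0]. *)

Require Import Defs.
From HB Require Import structures.
From mathcomp Require Import all_boot all_order all_algebra.
From mathcomp Require Import finmap.
From mathcomp Require Import all_classical all_reals all_analysis.
From mathcomp Require Import measurable_realfun.
From mathcomp Require Import ring lra.

Import Order.TTheory GRing.Theory Num.Theory.
Import numFieldNormedType.Exports.
Local Open Scope classical_set_scope.
Local Open Scope ring_scope.

(** * Regular variation from convergence along two dilations *)

Lemma subgroup_mulz {R : realType} (D : set R) (t : R) (k : int) :
  D 0 -> (forall s u, D s -> D u -> D (s + u)) -> (forall s, D s -> D (- s)) ->
  D t -> D (k%:~R * t).
Proof.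
move=> D0 DD DN Dt.
have Dn n : D (n%:R * t).
  elim: n => [|n IHn]; first by rewrite mul0r.
  by rewrite -natr1 mulrDl mul1r; apply: DD.
case: k => n; first exact: Dn.
by rewrite NegzE mulrNz mulNr; apply/DN/Dn.
Qed.

(** Eliminating [g] gives [2 ^ n = 3 ^ m] with positive exponents, which parity forbids. *)
Lemma ln2_ln3_incommensurable {R : realType} (g : R) (m n : nat) :
  ln 2 = m%:R * g -> ln 3 = n%:R * g -> False.
Proof.
move=> e2 e3.
have l3 : 0 < ln 3 :> R by apply: ln_gt0; rewrite ltr1n.
have l2 : 0 < ln 2 :> R by apply: ln_gt0; rewrite ltr1n.
have n0 : (0 < n)%N by case: n e3 l3 => // ->; rewrite mul0r ltxx.
have m0 : (0 < m)%N by case: m e2 l2 => // ->; rewrite mul0r ltxx.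
have : ln (2 ^+ n) = ln (3 ^+ m) :> R.
  by rewrite !lnXn ?ltr0n// e2 e3 -[LHS]mulr_natl -[RHS]mulr_natl mulrCA.
move/ln_inj; rewrite !posrE !exprn_gt0 ?ltr0n// => /(_ isT isT).
rewrite -!natrX => /eqP; rewrite eqr_nat => /eqP /(congr1 odd).
by rewrite !oddX /= orbF (gtn_eqF n0) (gtn_eqF m0).
Qed.

(** A subgroup of the reals without arbitrarily small positive elements is generated by its least
    positive element, and then [ln 2] and [ln 3] would be commensurable. *)
Lemma ln2_ln3_dense {R : realType} (D : set R) :
  D 0 -> (forall s u, D s -> D u -> D (s + u)) -> (forall s, D s -> D (- s)) ->
  D (ln 2) -> D (ln 3) ->
  forall x e : R, 0 < e -> exists t, [/\ D t, x < t & t < x + e].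
Proof.
move=> D0 DD DN D2 D3.
have l3 : 0 < ln 3 :> R by apply: ln_gt0; rewrite ltr1n.
have l2 : 0 < ln 2 :> R by apply: ln_gt0; rewrite ltr1n.
suff small e : 0 < e -> exists t, [/\ D t, 0 < t & t < e].
  move=> x e /small[d [Dd d0 de]].
  (* The first multiple of [d] beyond [x] overshoots by at most [d], hence by less than [e]. *)
  exists ((Num.floor (x / d) + 1)%:~R * d).
  have /andP[f1 f2] := floor_itv (x / d).
  split; first exact: subgroup_mulz.
    by rewrite -ltr_pdivrMr.
  rewrite intrD mulrDl mul1r; apply: ler_ltD => //.
  by rewrite -ler_pdivlMr.
move=> e0; apply: contrapT => nosmall.
have De t : D t -> 0 < t -> e <= t.
  by move=> Dt t0; rewrite leNgt; apply/negP => te; apply: nosmall; exists t.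
pose A := [set t | D t /\ 0 < t].
have A2 : A (ln 2) by split.
have Ainf : has_inf A.
  by split; [exists (ln 2)|exists e => t [Dt t0]; apply: De].
have gA t : A t -> inf A <= t by move=> At; apply: ge_inf => //; case: Ainf.
have [t [[Dt t0] tg]] : exists t, A t /\ t < inf A + e.
  by have [t At tl] := inf_adherent e0 Ainf; exists t.
(* The infimum is attained: otherwise two elements of [A] would lie within [e] of each other, and
   their difference would be a positive element of [D] below [e]. *)
have tE : t = inf A.
  apply/eqP; rewrite eq_le gA // andbT leNgt; apply/negP => gt.
  have /inf_adherent /(_ Ainf) [s As] : 0 < t - inf A by rewrite subr_gt0.
  rewrite addrC subrK => st.
  have := De (t - s) (DD _ _ Dt (DN _ As.1)); rewrite subr_gt0 => /(_ st).
  have := gA _ As; lra.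
(* Division with remainder by [t]: the remainder lies in [D] and is smaller than [t], the infimum of
   the positive elements, so it vanishes. *)
have mult u : D u -> 0 < u -> exists n : nat, u = n%:R * t.
  move=> Du u0; have ut0 : 0 <= u / t by rewrite divr_ge0 ?ltW.
  exists (Num.truncn (u / t)).
  have /andP[f1 f2] := truncn_itv ut0.
  apply/eqP; rewrite eq_sym -subr_eq0 eq_sym eq_le; apply/andP; split => [|].
    2:{ by rewrite subr_le0 -ler_pdivlMr. }
  rewrite leNgt; apply/negP; rewrite subr_lt0 => lt.
  have /gA : A (u - (Num.truncn (u / t))%:R * t).
    split; last by rewrite subr_gt0.
    by apply: (DD) => //; apply: (DN); rewrite pmulrn; exact: subgroup_mulz.
  move: f2; rewrite ltr_pdivrMr // -natr1 mulrDl mul1r -tE; lra.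
have [m em] := mult _ D2 l2.
have [n en] := mult _ D3 l3.
exact: ln2_ln3_incommensurable em en.
Qed.

(* Compare n t with m t1 for m = floor (n t / t1) and let n grow. *)
Lemma monotone_additive_proportional {R : realType} (S : R -> R -> Prop) (t1 tau1 : R) :
  S 0 0 ->
  (forall t u s v, S t u -> S s v -> S (t + s) (u + v)) ->
  (forall t u, S t u -> S (- t) (- u)) ->
  (forall t u, S t u -> 0 <= t -> 0 <= u) ->
  0 < t1 -> S t1 tau1 -> forall t u, S t u -> u = tau1 / t1 * t.
Proof.
move=> S0 SD SN Sge t10 S1.
have mulS (k : int) t u : S t u -> S (k%:~R * t) (k%:~R * u).
  move=> St; have Sn n : S (n%:R * t) (n%:R * u).
    elim: n => [|n IHn]; first by rewrite !mul0r.
    by rewrite -natr1 !mulrDl !mul1r; apply: SD.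
  by case: k => n; rewrite ?NegzE ?mulrNz ?mulNr; [exact: Sn|exact/SN/Sn].
have tau10 : 0 <= tau1 by apply: Sge S1 _; exact: ltW.
suff le t u : S t u -> tau1 / t1 * t <= u.
  move=> t u Stu; apply/eqP; rewrite eq_le le // andbT.
  have := le _ _ (SN _ _ Stu); lra.
move=> Stu; rewrite -subr_ge0 leNgt; apply/negP => neg.
pose a := tau1 / t1.
have key (n : nat) : - tau1 <= n%:R * (u - a * t).
  pose m := Num.floor (n%:R * t / t1).
  have /andP[f1 f2] := floor_itv (n%:R * t / t1).
  rewrite -/m intrD in f1 f2.
  have /Sge : S (n%:R * t - m%:~R * t1) (n%:R * u - m%:~R * tau1).
    by apply: SD; [exact: (mulS n)|apply/SN/mulS].
  rewrite subr_ge0 -ler_pdivlMr // => /(_ f1) h.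
  have : (n%:R * t / t1 - 1) * tau1 <= m%:~R * tau1.
    by apply: ler_wpM2r => //; rewrite lerBlDr ltW.
  have -> : (n%:R * t / t1 - 1) * tau1 = n%:R * (a * t) - tau1.
    by rewrite /a; field; rewrite gt_eqF.
  rewrite mulrBr; lra.
(* Chosen so that [n * (a * t - u)] exceeds [tau1], against [key]. *)
pose n := (Num.truncn (tau1 / (a * t - u))).+1.
have d0 : 0 < a * t - u by rewrite /a; lra.
have : tau1 / (a * t - u) < n%:R.
  by have /andP[] := truncn_itv (divr_ge0 tau10 (ltW d0)).
rewrite ltr_pdivrMr // => h.
have := key n; have -> : u - a * t = - (a * t - u) by ring.
rewrite mulrN; lra.
Qed.

(** Dilation and limit ratio are both recorded by their logarithms: for an eventually positive [G]
    the pairs [(t, tau)] then form an additive subgroup of the plane. *)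
Definition scaling {R : realType} (G : R -> R) (t tau : R) : Prop :=
  G (expR t * x) / G x @[x --> +oo] --> expR tau.

Definition ev_nondecreasing {R : realType} (G : R -> R) : Prop :=
  exists M : R, forall x y, M <= x -> x <= y -> G x <= G y.

Lemma cvg_near_eq {R : realType} {T : Type} {F : set_system T} {FF : Filter F}
  (f g : T -> R) (l : R) :
  (\forall x \near F, f x = g x) -> f x @[x --> F] --> l -> g x @[x --> F] --> l.
Proof.
move=> fg fl; apply: cvg_trans fl; apply: near_eq_cvg.
by apply: filterS fg => x ->.
Qed.

Lemma near_pinfty_ge {R : realType} (M : R) : \forall x \near +oo, M <= x.
Proof. exact: nbhs_pinfty_ge (num_real M). Qed.

Lemma cvgMl_pinfty {R : realType} (c : R) : 0 < c -> c * x @[x --> +oo] --> +oo.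
Proof.
move=> c0; apply/cvgryPge => A; near=> x.
rewrite mulrC -ler_pdivrMr //; near: x; exact: near_pinfty_ge.
Unshelve. all: by end_near. Qed.

Lemma near_scale {R : realType} (P : R -> Prop) (c : R) : 0 < c ->
  (\forall x \near +oo, P x) -> \forall x \near +oo, P (c * x).
Proof. by move=> /cvgMl_pinfty h Px; apply: h. Qed.

Lemma scaling0 {R : realType} (G : R -> R) :
  (\forall x \near +oo, 0 < G x) -> scaling G 0 0.
Proof.
move=> G0; rewrite /scaling expR0; apply: cvg_near_cst; near=> x.
by rewrite mul1r divff //; apply: lt0r_neq0; near: x.
Unshelve. all: by end_near. Qed.

(** The ratio for [t + s] telescopes through [G (expR s * x)]. *)
Lemma scalingD {R : realType} (G : R -> R) (t u s v : R) :
  (\forall x \near +oo, 0 < G x) ->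
  scaling G t u -> scaling G s v -> scaling G (t + s) (u + v).
Proof.
move=> G0 St Ss; rewrite /scaling !expRD.
have St' : G (expR t * (expR s * x)) / G (expR s * x) @[x --> +oo] --> expR u.
  exact: cvg_comp (cvgMl_pinfty _ (expR_gt0 s)) St.
apply: cvg_near_eq (cvgM St' Ss); near=> x.
have Gs : 0 < G (expR s * x).
  by near: x; apply: (near_scale (fun y => 0 < G y) _ (expR_gt0 s)).
by rewrite /= [LHS]mulrA divfK ?gt_eqF // mulrA.
Unshelve. all: by end_near. Qed.

Lemma scalingN {R : realType} (G : R -> R) (t u : R) :
  scaling G t u -> scaling G (- t) (- u).
Proof.
move=> St; rewrite /scaling (expRN u).
have St' : G (expR t * (expR (- t) * x)) / G (expR (- t) * x) @[x --> +oo] --> expR u.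
  exact: cvg_comp (cvgMl_pinfty _ (expR_gt0 (- t))) St.
apply: cvg_near_eq (cvgV (lt0r_neq0 (expR_gt0 u)) St'); near=> x.
by rewrite /= invf_div mulrA -expRD subrr expR0 mul1r.
Unshelve. all: by end_near. Qed.

Lemma scaling_ge0 {R : realType} (G : R -> R) (t u : R) :
  ev_nondecreasing G -> (\forall x \near +oo, 0 < G x) ->
  scaling G t u -> 0 <= t -> 0 <= u.
Proof.
move=> [M Gnd] G0 St t0; rewrite -ler_expR expR0.
apply: (cvgr_to_ge St); near=> x.
have Gx : 0 < G x by near: x.
rewrite ler_pdivlMr // mul1r; apply: Gnd; first by near: x; exact: near_pinfty_ge.
have x0 : 0 <= x by near: x; exact: near_pinfty_ge.
by rewrite ler_peMl // -expR0 ler_expR.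
Unshelve. all: by end_near. Qed.

(** Squeeze [t] between two nearby elements [s2 < t < s1] of [D]. Monotonicity encloses the ratio at
    [t] between the ratios at [s2] and [s1], whose limits are close by continuity of the
    exponential. *)
Lemma scaling_dense {R : realType} (G : R -> R) (a : R) (D : set R) :
  ev_nondecreasing G -> (\forall x \near +oo, 0 < G x) ->
  (forall x e : R, 0 < e -> exists t, [/\ D t, x < t & t < x + e]) ->
  (forall t, D t -> scaling G t (a * t)) ->
  forall t, scaling G t (a * t).
Proof.
move=> [M Gnd] G0 Ddense SD t; apply/cvgrPdist_le => e e0.
have cont : {for t, continuous (fun s => expR (a * s))}.
  apply: continuous_comp; last exact: continuous_expR.
  exact: mulrl_continuous.
have e20 : 0 < e / 2 by rewrite divr_gt0.
have /cvgrPdist_le/(_ _ e20)[d /= d0 hd] := cont.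
have [s1 [Ds1 ts1 s1t]] := Ddense t d d0.
have [s2 [Ds2 ts2 s2t]] := Ddense (t - d) d d0.
have hs1 : `|expR (a * t) - expR (a * s1)| <= e / 2.
  by apply: hd => /=; rewrite ltr_distl; apply/andP; split; lra.
have hs2 : `|expR (a * t) - expR (a * s2)| <= e / 2.
  by apply: hd => /=; rewrite ltr_distl; apply/andP; split; lra.
have /cvgrPdist_le/(_ _ e20) c1 := SD _ Ds1.
have /cvgrPdist_le/(_ _ e20) c2 := SD _ Ds2.
near=> x.
have x0 : 0 <= x by near: x; exact: near_pinfty_ge.
have Gx : 0 < G x by near: x.
have Ms2 : M <= expR s2 * x.
  by near: x; apply: (near_scale (fun y => M <= y) _ (expR_gt0 s2)); exact: near_pinfty_ge.
have le2 : G (expR s2 * x) / G x <= G (expR t * x) / G x.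
  rewrite ler_pM2r ?invr_gt0 //; apply: Gnd => //.
  by apply: ler_wpM2r => //; rewrite ler_expR; lra.
have le1 : G (expR t * x) / G x <= G (expR s1 * x) / G x.
  rewrite ler_pM2r ?invr_gt0 //; apply: Gnd.
    apply: le_trans Ms2 _; apply: ler_wpM2r => //; rewrite ler_expR; lra.
  by apply: ler_wpM2r => //; rewrite ler_expR; lra.
have : `|expR (a * s1) - G (expR s1 * x) / G x| <= e / 2 by near: x.
have : `|expR (a * s2) - G (expR s2 * x) / G x| <= e / 2 by near: x.
move: hs1 hs2 le1 le2; rewrite !ler_norml => /andP[? ?] /andP[? ?] ? ? /andP[? ?] /andP[? ?].
apply/andP; split; lra.
Unshelve. all: by end_near. Qed.

(** This is what a primitive of a function tending to zero at infinity satisfies, phrased without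
    derivatives. *)
Definition vanishing_slope {R : realType} (G : R -> R) : Prop :=
  forall e : R, 0 < e -> exists M : R, forall x y,
    M <= x -> x <= y -> `|G y - G x| <= e * (y - x).

(** Across a gap of at most [K] the increment of [G] tends to zero, while [G] stays above [c]. This
    serves to round arguments to integers. *)
Lemma cvg_ratio1 {R : realType} (G f g : R -> R) (c K : R) :
  0 < c -> (\forall x \near +oo, c <= G x) -> vanishing_slope G ->
  f x @[x --> +oo] --> +oo -> (forall x, 0 <= x -> f x <= g x <= f x + K) ->
  G (g x) / G (f x) @[x --> +oo] --> (1 : R).
Proof.
move=> c0 Gc sl fy fg; apply/cvgrPdist_le => e e0.
pose K1 := Num.max K 1.
have K10 : 0 < K1 by rewrite lt_max ltr01 orbT.
have [|M hM] := sl (e * c / K1); first by rewrite divr_gt0 // mulr_gt0.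
near=> x.
have Gfx : c <= G (f x) by near: x; apply: fy Gc.
have Mx : M <= f x by near: x; exact: fy _ (near_pinfty_ge M).
have x0 : 0 <= x by near: x; exact: near_pinfty_ge.
have /andP[f1 f2] := fg _ x0.
have Gp : 0 < G (f x) by apply: lt_le_trans Gfx.
have -> : 1 - G (g x) / G (f x) = - ((G (g x) - G (f x)) / G (f x)).
  by field; rewrite gt_eqF.
rewrite normrN normrM normfV (gtr0_norm Gp) ler_pdivrMr //.
apply: le_trans (hM _ _ Mx f1) _.
apply: (@le_trans _ _ (e * c)); last by rewrite ler_pM2l.
have dK : (g x - f x) / K1 <= 1.
  rewrite ler_pdivrMr // mul1r lerBlDl (le_trans f2) // lerD2l.
  by rewrite le_max lexx.
by rewrite mulrAC -mulrA ler_piMr // ltW // mulr_gt0.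
Unshelve. all: by end_near. Qed.

Lemma cvg_truncn {R : realType} : Num.truncn x @[x --> (+oo : set_system R)] --> \oo.
Proof.
apply/cvgrnyP/cvgryPge => A; near=> x.
have x0 : 0 <= x by near: x; exact: near_pinfty_ge.
have : A + 1 <= x by near: x; exact: near_pinfty_ge.
have /andP[_] := truncn_itv x0; rewrite -natr1; lra.
Unshelve. all: by end_near. Qed.

(** With [m] the integer part of [x], [G (k x) / G x] is the product of [G (k x) / G (k m)],
    [G (k m) / G m] and the inverse of [G x / G m]. The outer factors tend to 1, as the arguments
    differ by at most [k] and 1. *)
Lemma scaling_of_nat {R : realType} (G : R -> R) (k : nat) (c r : R) :
  (0 < k)%N -> 0 < c -> 0 < r -> (\forall x \near +oo, c <= G x) ->
  vanishing_slope G ->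
  G (k%:R * n%:R) / G n%:R @[n --> \oo] --> r -> scaling G (ln k%:R) (ln r).
Proof.
move=> k0 c0 r0 Gc sl Gr; rewrite /scaling !lnK ?posrE ?ltr0n //.
pose tr (x : R) : R := (Num.truncn x)%:R.
have trP x : 0 <= x -> tr x <= x <= tr x + 1.
  by move=> /truncn_itv /andP[h1 /ltW h2]; rewrite h1 natr1.
have trcvg : tr x @[x --> +oo] --> +oo by apply/cvgrnyP; exact: cvg_truncn.
have k0' : 0 < k%:R :> R by rewrite ltr0n.
have c1 : G x / G (tr x) @[x --> +oo] --> (1 : R).
  exact: cvg_ratio1 c0 Gc sl trcvg trP.
have c2 : G (k%:R * x) / G (k%:R * tr x) @[x --> +oo] --> (1 : R).
  apply: (cvg_ratio1 G (fun x => k%:R * tr x) (fun x => k%:R * x) c k%:R) => //.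
    exact: cvg_comp trcvg (cvgMl_pinfty _ k0').
  move=> x /trP /andP[h1 h2]; rewrite ler_pM2l // h1 /=.
  by rewrite -[X in _ + X]mulr1 -mulrDr ler_pM2l.
have c3 : G (k%:R * tr x) / G (tr x) @[x --> +oo] --> r.
  exact: cvg_comp cvg_truncn Gr.
have := cvgM (cvgM c2 c3) (cvgV (oner_neq0 R) c1).
rewrite mul1r invr1 mulr1 => /(_ _ _ _) h; apply: cvg_near_eq h; near=> x.
have Gx : c <= G x by near: x.
have Gtx : c <= G (tr x) by near: x; apply: trcvg Gc.
have Gktx : c <= G (k%:R * tr x).
  by near: x; exact: (cvg_comp _ _ trcvg (cvgMl_pinfty _ k0')) _ Gc.
by rewrite /=; field; rewrite !gt_eqF //; apply: lt_le_trans c0 _.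
Unshelve. all: by end_near. Qed.

(** Starting from an integer [m] beyond [M], iteration gives [G (2 ^ k * m) >= 2 ^ k * c], so
    [G n / n] is at least [c / m] infinitely often. *)
Lemma doubling_lt {R : realType} (G : R -> R) (c M : R) :
  0 < c -> (forall x, M <= x -> c <= G x /\ 2 * G x <= G (2 * x)) ->
  ~ (G n%:R / n%:R @[n --> \oo] --> (0 : R)).
Proof.
move=> c0 hM G0.
pose m := (Num.truncn (Num.max M 1)).+1.
have Mm : Num.max M 1 <= m%:R.
  have /truncn_itv /andP[_ /ltW] // : 0 <= Num.max M 1.
  by rewrite le_max ler01 orbT.
have Mm' : M <= m%:R by apply: le_trans Mm; rewrite le_max lexx.
have m0 : 0 < m%:R :> R by rewrite ltr0n.
have pw k : m%:R <= (2 ^ k * m)%:R :> R.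
  by rewrite ler_nat leq_pmull // expn_gt0.
have grow k : (2 ^ k)%:R * c <= G (2 ^ k * m)%:R.
  elim: k => [|k IHk]; first by rewrite expn0 mul1n mul1r; case: (hM _ Mm').
  have [_] := hM _ (le_trans Mm' (pw k)).
  by rewrite expnS -mulnA !natrM => /(le_trans _); apply; rewrite -mulrA ler_pM2l // -natrM.
have e0 : 0 < c / m%:R by rewrite divr_gt0.
have /cvgrPdist_lt/(_ _ e0)[N _ hN] := G0.
have := hN (2 ^ N * m)%N; rewrite /= sub0r normrN => h.
have {h} : `|G (2 ^ N * m)%:R / (2 ^ N * m)%:R| < c / m%:R.
  apply: h; apply: (@leq_trans (2 ^ N)); first exact/ltnW/ltn_expl.
  by rewrite leq_pmulr.
apply/negP; rewrite -leNgt; apply: le_trans (ler_norm _).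
rewrite ler_pdivlMr ?ltr0n ?muln_gt0 ?expn_gt0 //.
rewrite [leLHS](_ : _ = (2 ^ N)%:R * c) //.
by rewrite natrM mulrA mulrAC divfK ?gt_eqF // mulrC.
Qed.

Lemma regularly_varying_of_nondecreasing {R : realType} (G : R -> R) (c r2 r3 : R) :
  ev_nondecreasing G -> vanishing_slope G ->
  0 < c -> (\forall x \near +oo, c <= G x) ->
  G n%:R / n%:R @[n --> \oo] --> (0 : R) ->
  G (2 * n%:R) / G n%:R @[n --> \oo] --> r2 ->
  G (3 * n%:R) / G n%:R @[n --> \oo] --> r3 ->
  exists a, 0 <= a <= 1 /\ regularly_varying G a.
Proof.
move=> Gnd sl c0 Gc Gn G2 G3.
have G0 : \forall x \near +oo, 0 < G x.
  by apply: filterS Gc => x; exact: lt_le_trans.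
have ratio1 (k : nat) r : (0 < k)%N ->
    G (k%:R * n%:R) / G n%:R @[n --> \oo] --> r -> 0 < r.
  move=> k0 Gk; apply: lt_le_trans ltr01 _; apply: (cvgr_to_ge Gk).
  have [M hM] := Gnd; near=> n.
  have Gx : 0 < G n%:R by near: n; apply: cvgr_idn G0.
  rewrite ler_pdivlMr // mul1r; apply: hM.
    by near: n; exact: cvgr_idn _ (near_pinfty_ge M).
  by rewrite ler_peMl // ler1n.
have S2 := scaling_of_nat G 2 c r2 isT c0 (ratio1 2 r2 isT G2) Gc sl G2.
have S3 := scaling_of_nat G 3 c r3 isT c0 (ratio1 3 r3 isT G3) Gc sl G3.
have l2 : 0 < ln 2 :> R by apply: ln_gt0; rewrite ltr1n.
(* The only possible index: all pairs of [scaling] lie on the line through the origin and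
   [(ln 2, ln r2)]. *)
pose a := ln r2 / ln 2.
have SD t u s v := scalingD G t u s v G0.
have Sge t u := scaling_ge0 G t u Gnd G0.
have lin t u : scaling G t u -> u = a * t.
  exact: (monotone_additive_proportional (scaling G) _ _ (scaling0 G G0) SD (scalingN G) Sge l2 S2).
have Sa t : scaling G t (a * t).
  move: t; apply: (scaling_dense G a [set t | scaling G t (a * t)]) => //.
  apply: ln2_ln3_dense => /=.
  - by rewrite mulr0; exact: scaling0.
  - by move=> s u; rewrite mulrDr; exact: SD.
  - by move=> s; rewrite mulrN; exact: scalingN.
  - by rewrite -(lin _ _ S2).
  - by rewrite -(lin _ _ S3).
exists a; split; last split.
- apply/andP; split; first by rewrite divr_ge0 ?(Sge _ _ S2) ?ltW.
  (* If [a] exceeded 1, [G (2 x) / G x] would tend to [2 ^ a > 2]; then [G] would eventually at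
     least double whenever [x] doubles, and [G n / n] could not tend to zero. *)
  rewrite leNgt; apply/negP => a1.
  have lt2 : 2 < expR (a * ln 2).
    by rewrite -[X in X < _](lnK (_ : 2 \is Num.pos)) ?posrE // ltr_expR ltr_pMl.
  have h : \forall x \near +oo, c <= G x /\ 2 * G x <= G (2 * x).
    near=> x; have Gx : c <= G x by near: x.
    split=> //; rewrite -ler_pdivlMr; last exact: lt_le_trans Gx.
    rewrite ltW //; near: x; have := Sa (ln 2); rewrite /scaling lnK ?posrE // => S.
    exact: cvgr_gt S _ lt2.
  have [M [_ hM]] := h.
  (* [M + 1] because neighbourhoods of [+oo] are given by strict inequalities. *)
  apply: (doubling_lt G c (M + 1) c0 _ Gn) => x Mx; apply: hM.
  by apply: lt_le_trans Mx; rewrite ltrDl.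
- near=> n; rewrite gt_eqF //; near: n; exact: cvgr_idn G0.
- move=> x x0; rewrite /powR gt_eqF //.
  have := Sa (ln x); rewrite /scaling lnK ?posrE // => S.
  exact: cvg_comp cvgr_idn S.
Unshelve. all: by end_near. Qed.

Lemma regularly_varying_of_nonincreasing {R : realType} (G : R -> R) (c : R) :
  ev_nondecreasing (\- G) -> 0 < c -> (\forall x \near +oo, c <= G x) ->
  regularly_varying G 0.
Proof.
move=> [M0 Gni] c0 [M1 [_ Gc]].
pose M := Num.max M0 (M1 + 1).
have M0M : M0 <= M by rewrite le_max lexx.
have M1M : M1 < M by rewrite lt_max ltrDl ltr01 orbT.
have Gc' x : M <= x -> c <= G x by move=> Mx; apply: Gc; apply: lt_le_trans Mx.
have Gni' x y : M <= x -> x <= y -> G y <= G x.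
  by move=> Mx xy; have := Gni x y (le_trans M0M Mx) xy; rewrite lerN2.
pose A := [set G x | x in [set x | M <= x]].
have Ainf : has_inf A.
  by split; [exists (G M), M => /=|exists c => _ [x Mx <-]; exact: Gc'].
(* The limit of [G] at infinity, positive since [c] bounds these values from below. *)
pose L := inf A.
have L0 : c <= L.
  by apply: lb_le_inf; [case: Ainf|move=> _ [x Mx <-]; exact: Gc'].
have Lpos : 0 < L by apply: lt_le_trans L0.
have GL : G x @[x --> +oo] --> L.
  apply/cvgrPdist_le => e e0.
  have [_ [x0 Mx0 <-] hx0] := inf_adherent e0 Ainf.
  near=> x.
  have x0x : x0 <= x by near: x; exact: near_pinfty_ge.
  have Lx : L <= G x.
    by apply: ge_inf; [case: Ainf|exists x => //=; apply: le_trans x0x].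
  rewrite distrC ger0_norm ?subr_ge0 // lerBlDl.
  by apply: le_trans (ltW hx0); apply: Gni'.
split.
  near=> n; rewrite gt_eqF //; apply: lt_le_trans c0 _; apply: Gc'.
  by near: n; exact: cvgr_idn _ (near_pinfty_ge M).
move=> x x0; rewrite powRr0.
have Gn : G n%:R @[n --> \oo] --> L by exact: cvg_comp cvgr_idn GL.
have xny : x * n%:R @[n --> \oo] --> +oo.
  exact: cvg_comp cvgr_idn (cvgMl_pinfty _ x0).
have Gxn : G (x * n%:R) @[n --> \oo] --> L by exact: cvg_comp xny GL.
have := cvgM Gxn (cvgV (lt0r_neq0 Lpos) Gn).
by rewrite divff ?gt_eqF //; apply.
Unshelve. all: by end_near. Qed.

(** * The tail function of a charge and its primitive *)

Lemma set_ge_itv {R : realType} (x : R) : [set t | x <= t] = `[x, +oo[%classic.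
Proof. by apply/seteqP; split => t /=; rewrite in_itv/= andbT. Qed.

Lemma tail_measure_nonincreasing {R : realType} (mu : {measure set R -> \bar R}) (x y : R) :
  (mu setT < +oo)%E -> x <= y ->
  fine (mu [set t | y <= t]) <= fine (mu [set t | x <= t]).
Proof.
move=> muT xy.
have fin (z : R) : mu [set t | z <= t] \is a fin_num.
  rewrite ge0_fin_numE //; apply: le_lt_trans muT.
  by apply: le_measure; rewrite ?inE ?set_ge_itv.
rewrite fine_le //; apply: le_measure; rewrite ?inE ?set_ge_itv //.
by move=> t /=; rewrite !in_itv /= !andbT; exact: le_trans.
Qed.

(** Continuity from above of a finite measure along the integers, extended to real [x] by
    monotonicity of the tail. *)
Lemma tail_measure_vanish {R : realType} (mu : {measure set R -> \bar R}) :
  (mu setT < +oo)%E -> forall e : R, 0 < e ->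
  exists M : R, forall x, M <= x -> `|fine (mu [set t | x <= t])| <= e.
Proof.
move=> muT e e0.
have : (mu \o (fun n : nat => [set t : R | n%:R <= t])) n @[n --> \oo] -->
    mu (\bigcap_n [set t : R | n%:R <= t]).
  apply: nonincreasing_cvg_mu.
  - by apply: le_lt_trans muT; apply: le_measure; rewrite ?inE ?set_ge_itv.
  - by move=> n; rewrite set_ge_itv.
  - by apply: bigcap_measurable => // n _; rewrite set_ge_itv.
  - by move=> m n mn; apply/subsetPset => t /=; apply: le_trans; rewrite ler_nat.
have -> : \bigcap_n [set t : R | n%:R <= t] = set0.
  apply/seteqP; split => // t /= h.
  have /(_ I) /= := h (Num.truncn (Num.max t 0)).+1; apply/negP; rewrite -ltNge.
  have /truncn_itv /andP[_] : 0 <= Num.max t 0 by rewrite le_max lexx orbT.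
  by apply: le_lt_trans; rewrite le_max lexx.
rewrite measure0 => /fine_cvg /cvgrPdist_le /(_ _ e0)[N _ hN].
exists N%:R => x Nx; have := hN N (leqnn N); rewrite /= sub0r normrN.
apply: le_trans; rewrite !ger0_norm ?fine_ge0 //.
exact: tail_measure_nonincreasing.
Qed.

(** The Jordan decomposition makes [F] a difference of two bounded nonincreasing tails;
    measurability, boundedness and decay of [F] are all read off from it. *)
Lemma Ffun_decomp {R : realType} (beta : {charge set R -> \bar R}) :
  exists mu nu : {measure set R -> \bar R},
    [/\ (mu setT < +oo)%E, (nu setT < +oo)%E &
     forall x, Ffun beta x = fine (mu [set t | x <= t]) - fine (nu [set t | x <= t])].
Proof.
have [P [N nuPN]] := Hahn_decomposition beta.
exists (jordan_pos nuPN), (jordan_neg nuPN).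
split; try by rewrite -ge0_fin_numE // fin_num_measure.
move=> x; rewrite /Ffun (jordan_decomp nuPN) ?set_ge_itv // /cadd /= cscaleN1 fineD ?fineN //.
  by rewrite fin_num_measure.
by rewrite fin_numN fin_num_measure.
Qed.

Lemma measurable_Ffun {R : realType} (beta : {charge set R -> \bar R}) :
  measurable_fun [set: R] (Ffun beta).
Proof.
have [mu [nu [muT nuT FE]]] := Ffun_decomp beta.
rewrite (_ : Ffun beta = (fun x => fine (mu [set t | x <= t])) \-
                         (fun x => fine (nu [set t | x <= t]))); last exact/funext.
by apply: measurable_funB; apply: nonincreasing_measurable => // x y xy;
   exact: tail_measure_nonincreasing.
Qed.

Lemma Ffun_vanish {R : realType} (beta : {charge set R -> \bar R}) (e : R) :
  0 < e -> exists M : R, forall x, M <= x -> `|Ffun beta x| <= e.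
Proof.
have [mu [nu [muT nuT FE]]] := Ffun_decomp beta.
move=> e0; have e20 : 0 < e / 2 by rewrite divr_gt0.
have [M1 h1] := tail_measure_vanish mu muT _ e20.
have [M2 h2] := tail_measure_vanish nu nuT _ e20.
exists (Num.max M1 M2) => x; rewrite ge_max => /andP[x1 x2].
rewrite FE (splitr e) (le_trans (ler_normB _ _)) //.
by apply: lerD; [exact: h1|exact: h2].
Qed.

Lemma Ffun_bounded {R : realType} (beta : {charge set R -> \bar R}) :
  exists K : R, forall x, `|Ffun beta x| <= K.
Proof.
have [mu [nu [muT nuT FE]]] := Ffun_decomp beta.
have le (m : {measure set R -> \bar R}) (x : R) : (m setT < +oo)%E ->
    `|fine (m [set t | x <= t])| <= fine (m setT).
  move=> mT; rewrite ger0_norm ?fine_ge0 //.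
  have h : (m [set t | (x <= t)%R] <= m setT)%E by apply: le_measure; rewrite ?inE ?set_ge_itv.
  by rewrite fine_le // ge0_fin_numE // (le_lt_trans h).
exists (fine (mu setT) + fine (nu setT)) => x.
by rewrite FE (le_trans (ler_normB _ _)) // lerD ?le.
Qed.

(** Both tails are closed on the left, so their difference is exactly a right-open interval; hence
    the right-open intervals in the moment computations. *)
Lemma charge_itv_Ffun {R : realType} (beta : {charge set R -> \bar R}) (a b : R) :
  a <= b -> beta `[a, b[%classic = (Ffun beta a - Ffun beta b)%:E.
Proof.
move=> ab.
rewrite /Ffun !set_ge_itv (@itv_bndbnd_setU _ _ (BLeft a) (BLeft b) (BInfty _ false)) ?bnd_simp //.
rewrite chargeU //=; last first.
  apply/seteqP; split => // t [] /=; rewrite !in_itv /= => /andP[_ tb].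
  by rewrite leNgt tb.
by rewrite fineD ?fin_num_measure // addrK fineK // fin_num_measure.
Qed.

(** * Integrals and primitives of bounded measurable functions *)

Lemma integrable_bounded {R : realType} (f : R -> R) (K a b : R) :
  measurable_fun [set: R] f -> (forall x, `|f x| <= K) ->
  (@lebesgue_measure R).-integrable `[a, b] (EFin \o f).
Proof.
move=> mf fK; apply: measurable_bounded_integrable => //.
- by rewrite /= lebesgue_measure_itv /=; case: ifP => // _; rewrite -EFinB ltry.
- exact: measurable_funTS.
- exists K; split; first exact: num_real.
  by move=> M /ltW KM x _; apply: le_trans KM.
Qed.

Lemma Rintegral_chasles {R : realType} (f : R -> R) (K a b c : R) :
  measurable_fun [set: R] f -> (forall x, `|f x| <= K) -> a <= b -> b <= c ->
  \int[@lebesgue_measure R]_(x in `[a, c]) f x =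
  \int[@lebesgue_measure R]_(x in `[a, b]) f x +
  \int[@lebesgue_measure R]_(x in `[b, c]) f x.
Proof.
move=> mf fK ab bc; apply/eqP; rewrite addrC -subr_eq; apply/eqP.
rewrite Rintegral_itvB ?bnd_simp //; last exact: integrable_bounded mf fK.
rewrite Rintegral_itv_obnd_cbnd //.
apply: (integrableS _ _ _ (integrable_bounded f K b c mf fK)) => //.
by apply: subset_itvr; rewrite bnd_simp.
Qed.

(* One of the two integrals is over an empty or one-point interval. *)
Definition primitive {R : realType} (f : R -> R) (x : R) : R :=
  \int[@lebesgue_measure R]_(t in `[0, x]) f t -
  \int[@lebesgue_measure R]_(t in `[x, 0]) f t.

Lemma Rintegral_itv_deg {R : realType} (f : R -> R) (a b : R) :
  b <= a -> \int[@lebesgue_measure R]_(t in `[a, b]) f t = 0.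
Proof.
rewrite le_eqVlt => /predU1P[->|ba]; first by rewrite set_itv1 Rintegral_set1.
by rewrite set_itv_ge ?Rintegral_set0 // bnd_simp -ltNge.
Qed.

Lemma primitiveB {R : realType} (f : R -> R) (K u v : R) :
  measurable_fun [set: R] f -> (forall x, `|f x| <= K) -> u <= v ->
  primitive f v - primitive f u = \int[@lebesgue_measure R]_(t in `[u, v]) f t.
Proof.
move=> mf fK uv; rewrite /primitive.
have ch := Rintegral_chasles f K _ _ _ mf fK.
case: (lerP 0 u) => [u0|/ltW u0].
  have v0 := le_trans u0 uv.
  by rewrite (ch 0 u v) // (Rintegral_itv_deg _ v 0) // (Rintegral_itv_deg _ u 0) //; ring.
case: (lerP 0 v) => [v0|/ltW v0].
  by rewrite (ch u 0 v) // (Rintegral_itv_deg _ v 0) // (Rintegral_itv_deg _ 0 u) //; ring.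
by rewrite (ch u v 0) // (Rintegral_itv_deg _ 0 v) // (Rintegral_itv_deg _ 0 u) //; ring.
Qed.

Lemma Rintegral_itv_cst {R : realType} (u v c : R) : u <= v ->
  \int[@lebesgue_measure R]_(x in `[u, v]) c = c * (v - u).
Proof.
move=> uv; rewrite Rintegral_cst //= lebesgue_measure_itv /= lte_fin.
case: ltP => // vu; have -> : v = u by apply/eqP; rewrite eq_le vu uv.
by rewrite subrr.
Qed.

Lemma primitive_le {R : realType} (f : R -> R) (K u v c : R) :
  measurable_fun [set: R] f -> (forall x, `|f x| <= K) -> u <= v ->
  (forall x, u <= x -> f x <= c) -> primitive f v - primitive f u <= c * (v - u).
Proof.
move=> mf fK uv fc; rewrite (primitiveB f K) // -Rintegral_itv_cst //.
apply: le_Rintegral => //; first exact: integrable_bounded mf fK.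
  by apply: (integrable_bounded (cst c) `|c|).
by move=> x /=; rewrite in_itv /= => /andP[ux _]; exact: fc.
Qed.

Lemma primitive_ge {R : realType} (f : R -> R) (K u v c : R) :
  measurable_fun [set: R] f -> (forall x, `|f x| <= K) -> u <= v ->
  (forall x, u <= x -> c <= f x) -> c * (v - u) <= primitive f v - primitive f u.
Proof.
move=> mf fK uv fc; rewrite (primitiveB f K) // -Rintegral_itv_cst //.
apply: le_Rintegral => //; last 2 first.
- exact: integrable_bounded mf fK.
- by move=> x /=; rewrite in_itv /= => /andP[ux _]; exact: fc.
by apply: (integrable_bounded (cst c) `|c|).
Qed.

(** By uniqueness of Lebesgue measure only intervals need checking; the reflection exchanges their
    open and closed ends. *)
Lemma lebesgue_measure_reflect {R : realType} (s : R) (A : set R) : measurable A ->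
  pushforward (@lebesgue_measure R) (fun y : measurableTypeR R => s - y : measurableTypeR R) A
  = lebesgue_measure A.
Proof.
have mphi : measurable_fun [set: measurableTypeR R]
    (fun y : measurableTypeR R => s - y : measurableTypeR R).
  exact: measurable_funB.
move=> mA; apply/esym/lebesgue_measure_unique => //= _ [[a b]] _ <-.
rewrite /pushforward.
rewrite (_ : _ @^-1` _ = `[s - b, s - a[%classic); last first.
  apply/seteqP; split => y /=; rewrite !in_itv /= => /andP[h1 h2]; apply/andP; split; lra.
rewrite !lebesgue_measure_itv /= !lte_fin ltrD2l ltrN2; case: ifP => // _.
by rewrite -!EFinB; congr EFin; lra.
Qed.

Lemma Rintegral_reflect {R : realType} (f : R -> R) (K s u v : R) :
  measurable_fun [set: R] f -> (forall x, `|f x| <= K) -> u <= v ->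
  \int[@lebesgue_measure R]_(y in `[u, v]) f (s - y) =
  primitive f (s - u) - primitive f (s - v).
Proof.
move=> mf fK uv; rewrite (primitiveB f K) //; last by rewrite lerD2l lerN2.
have mphi : measurable_fun [set: measurableTypeR R]
    (fun y : measurableTypeR R => s - y : measurableTypeR R).
  exact: measurable_funB.
have E : (fun y : measurableTypeR R => s - y : measurableTypeR R) @^-1`
    `[s - v, s - u] = `[u, v]%classic.
  apply/seteqP; split => y /=; rewrite !in_itv /= => /andP[h1 h2]; apply/andP; split; lra.
rewrite /Rintegral; congr fine.
have intf : (@lebesgue_measure R).-integrable
    ((fun y : measurableTypeR R => s - y : measurableTypeR R) @^-1` `[s - v, s - u])
    ((EFin \o f) \o (fun y => s - y)).
  rewrite E; apply: (integrable_bounded (f \o (fun y => s - y)) K) => //.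
    exact: measurableT_comp.
  by move=> y; exact: fK.
have := integral_pushforward mphi _ intf.
rewrite E => P; apply: etrans (esym (P _ _)) _ => //.
  exact/measurable_EFinP.
by apply: eq_measure_integral => A mA _; exact: lebesgue_measure_reflect.
Qed.

(** * Second moments of counts *)

Lemma card_fsetX {K1 K2 : choiceType} (A : {fset K1}) (B : {fset K2}) :
  #|` (A `*` B)%fset| = (#|` A| * #|` B|)%N.
Proof.
rewrite (perm_size (enum_imfset2 _ _)) ?size_allpairs //.
by move=> [x1 y1] [x2 y2] _ _ /= [-> ->].
Qed.

Lemma npts_card {R : realType} (S W : set R) : finite_set (S `&` W) ->
  npts S W = (#|` fset_set (S `&` W)|)%:R%:E.
Proof. by move=> f; rewrite /npts /counting asboolT. Qed.

(** Pairs in the product either lie on the diagonal, where they are the points of [A] and [B] in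
    common, or have distinct entries. The latter are what the factorial moment measure counts. *)
Lemma npts_mul {R : realType} (S A B : set R) :
  finite_set (S `&` A) -> finite_set (S `&` B) ->
  (npts S A * npts S B = npts S (A `&` B) + counting (distinct_pairs S `&` (A `*` B)))%E.
Proof.
move=> fA fB.
have fX := finite_setX fA fB.
have fAB : finite_set (S `&` (A `&` B)).
  by apply: sub_finite_set fA => x [Sx [Ax _]].
have fD : finite_set (distinct_pairs S `&` (A `*` B)).
  by apply: sub_finite_set fX => -[x y] [[/= Sx [Sy _]] [/= Ax By]].
rewrite !npts_card // /counting asboolT // -EFinM -EFinD -natrM -natrD.
congr (_%:R%:E).
rewrite -card_fsetX -fset_setX //.
pose Dg : set (R * R) := [set (x, x) | x in S `&` (A `&` B)].
have fDg : finite_set Dg by exact: finite_image.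
have -> : (S `&` A) `*` (S `&` B) = Dg `|` (distinct_pairs S `&` (A `*` B)).
  apply/seteqP; split => [[x y] /= [[Sx Ax] [Sy By]]|[x y]].
    have [xy|xy] := eqVneq x y; last by right; split => //; do 2 split => //; exact/eqP.
    by left; exists x; rewrite ?xy //; split => //; split => //; rewrite -xy.
  by case=> [[z [Sz [Az Bz]] [<- <-]]|[[/= Sx [Sy _]] [/= Ax By]]].
rewrite fset_setU // cardfsU -fset_setI //.
have -> : Dg `&` (distinct_pairs S `&` (A `*` B)) = set0.
  by apply/seteqP; split => // -[x y] [[z _ [<- <-]]] [[_ [_ /=]]].
rewrite fset_set0 cardfs0 subn0; congr addn.
rewrite fset_set_image // card_in_imfset //=.
by move=> x y _ _ [].
Qed.

Lemma finite_pts {R : realType} (S W : set R) (a b : R) :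
  locally_finite S -> W `<=` `[a, b] -> finite_set (S `&` W).
Proof. by move=> /(_ a b) fS Wab; apply: sub_finite_set fS; exact: setIS. Qed.

Section counts.
Context {R : realType} {d : measure_display} {T : measurableType d}
  (P : probability T R) (eta : T -> set R).
Hypothesis pp : point_process eta.

Lemma npts_cnt (W : set R) (a b : R) (w : T) : W `<=` `[a, b] ->
  npts (eta w) W = (cnt eta W w)%:E.
Proof.
move=> Wab; rewrite /cnt fineK //.
by rewrite npts_card //; apply: finite_pts Wab; case: pp.
Qed.

Lemma cnt_nat (W : set R) (a b : R) (w : T) : W `<=` `[a, b] ->
  exists n : nat, cnt eta W w = n%:R.
Proof.
move=> Wab; rewrite /cnt npts_card /=; first by eexists.
by apply: finite_pts Wab; case: pp.
Qed.

Lemma measurable_cnt (W : set R) : measurable W -> measurable_fun [set: T] (cnt eta W).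
Proof.
move=> mW; case: pp => _ /(_ W mW) h.
exact: measurableT_comp (fine_measurable _) h.
Qed.

Lemma cnt_mul (A B : set R) (a b : R) (w : T) : A `<=` `[a, b] -> B `<=` `[a, b] ->
  (cnt eta A w * cnt eta B w)%:E =
  ((cnt eta (A `&` B) w)%:E + counting (distinct_pairs (eta w) `&` (A `*` B)))%E.
Proof.
move=> Aab Bab; rewrite EFinM -!(npts_cnt _ a b) //; last by move=> x [/Aab].
by apply: npts_mul; [apply: finite_pts Aab|apply: finite_pts Bab]; case: pp.
Qed.

Lemma cnt_ge0 (W : set R) (w : T) : 0 <= cnt eta W w.
Proof.
by rewrite /cnt fine_ge0.
Qed.

Lemma integral_cnt_mul (A B : set R) (a b : R) :
  unit_intensity P eta ->
  measurable A -> measurable B -> A `<=` `[a, b] -> B `<=` `[a, b] ->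
  (\int[P]_w (cnt eta A w * cnt eta B w)%:E =
   @lebesgue_measure R (A `&` B) + alpha2 P eta (A `*` B))%E.
Proof.
move=> ui mA mB Aab Bab.
have ABab : A `&` B `<=` `[a, b] by move=> x [/Aab].
have mAB : measurable (A `&` B) by exact: measurableI.
rewrite -(ui _ mAB) /alpha2.
under eq_integral do rewrite (cnt_mul _ _ a b) //.
rewrite ge0_integralD //=.
- by congr (_ + _)%E; apply: eq_integral => w _; rewrite (npts_cnt _ a b).
- by move=> w _; rewrite lee_fin cnt_ge0.
- exact/measurable_EFinP/measurable_cnt.
(* Measurability of the number of distinct pairs is obtained by writing it as a difference of
   measurable counts, legitimate because all of them are finite. *)
- have h : forall w, counting (distinct_pairs (eta w) `&` (A `*` B)) =
      (cnt eta A w * cnt eta B w - cnt eta (A `&` B) w)%:E.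
    move=> w; rewrite EFinB (cnt_mul _ _ a b) // addeAC subee ?add0e //.
  apply: (eq_measurable_fun (fun w => (cnt eta A w * cnt eta B w - cnt eta (A `&` B) w)%:E)).
    by move=> w _; rewrite h.
  apply/measurable_EFinP; apply: measurable_funB; last exact: measurable_cnt.
  by apply: measurable_funM; exact: measurable_cnt.
Qed.

(** The expected number of points at [q] is the Lebesgue measure of a singleton, so almost surely
    [q] is not a point of the process. *)
Lemma pts_itv_ae (p q : R) : unit_intensity P eta -> p <= q ->
  {ae P, forall w, eta w `&` `[p, q] = eta w `&` `[p, q[}.
Proof.
move=> ui pq.
have h0 : (\int[P]_w `|npts (eta w) [set q]| = 0)%E.
  transitivity (\int[P]_w npts (eta w) [set q])%E.
    by apply: eq_integral => w _; rewrite gee0_abs.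
  by rewrite ui // lebesgue_measure_set1.
have mq : measurable_fun [set: T] ((fun w => npts (eta w) [set q]) : T -> \bar R).
  by case: pp => _; apply.
have := (ae_eq_integral_abs P measurableT mq).1 h0.
apply: filterS => w /(_ I) /= hq.
have q0 : ~ eta w q.
  move=> qw; move: hq.
  have sq : eta w `&` [set q] = [set q] by apply/seteqP; split => [x []|x ->].
  rewrite npts_card ?sq //.
  by rewrite fset_set1 cardfs1 => /eqP; rewrite eqe oner_eq0.
apply/seteqP; split => x [xw] /=; rewrite !in_itv /= => /andP[px xq]; split => //.
  rewrite px /= lt_neqAle xq andbT; apply/eqP => xE; apply: q0; by rewrite -xE.
by rewrite px ltW.
Qed.

End counts.

(** * Second moments expressed by the primitive of [F] *)

Section moments.
Context {R : realType} {d : measure_display} {T : measurableType d}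
  (P : probability T R) (eta : T -> set R)
  (ar : {measure set R -> \bar R}) (beta : {charge set R -> \bar R}).
Hypothesis pp : point_process eta.
Hypothesis ui : unit_intensity P eta.
Hypothesis rs : reduced_second_moment P eta ar.
Hypothesis tp : truncated_pair_correlation ar beta.

Local Notation Phi := (primitive (Ffun beta)).

Lemma reduced_moment_itv (p q : R) : p <= q ->
  ar `[p, q[%classic = (Ffun beta p - Ffun beta q + (q - p))%:E.
Proof.
move=> pq.
have lam : (@lebesgue_measure R) `[p, q[%classic = (q - p)%:E.
  rewrite lebesgue_measure_itv /= lte_fin; case: ltP => // qp.
  by have -> : p = q; [apply/eqP; rewrite eq_le pq|rewrite subrr].
have := tp `[p, q[%classic _ _; rewrite charge_itv_Ffun // lam => h.
have {h} : (Ffun beta p - Ffun beta q)%:E = (ar `[p, q[%classic - (q - p)%:E)%E.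
  apply: h => //; exists p, q => x /=; rewrite !in_itv /= => /andP[-> /ltW ->] //.
(* An infinite value of [ar] is excluded, since the left-hand side is finite. *)
have := measure_ge0 ar `[p, q[%classic.
case: (ar _) => [r| |] //= _ [->].
by rewrite subrK.
Qed.

(** For [y] in [[u, v]] the section in [x] is [[p - y, q - y[], of reduced moment
    [F (p - y) - F (q - y) + (q - p)]. Integrating over [y] by reflection produces the values of
    [Phi]. *)
Lemma alpha2_itv (p q u v : R) : p <= q -> u <= v ->
  alpha2 P eta (`[p, q[%classic `*` `[u, v]%classic) =
  ((q - p) * (v - u) + (Phi (p - u) - Phi (p - v)) - (Phi (q - u) - Phi (q - v)))%:E.
Proof.
move=> pq uv.
have [K FK] := Ffun_bounded beta.
have mF := measurable_Ffun beta.
have mFs (s : R) : measurable_fun [set: R] (fun y => Ffun beta (s - y)).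
  by apply: measurableT_comp => //; exact: measurable_funB.
have iF (s : R) : (@lebesgue_measure R).-integrable `[u, v] (EFin \o (fun y => Ffun beta (s - y))).
  by apply: (integrable_bounded _ K).
rewrite rs; last exact: measurableX.
pose g y := Ffun beta (p - y) - Ffun beta (q - y) + (q - p).
transitivity (\int[@lebesgue_measure R]_(y in `[u, v]) (g y)%:E)%E.
  rewrite [RHS]integral_mkcond; apply: eq_integral => y _.
  rewrite /patch; case: ifPn => [|yB].
    rewrite inE => yB.
    transitivity (\int[ar]_x (\1_`[p - y, q - y[ x)%:E)%E.
      apply: eq_integral => x _; congr EFin; rewrite !indicE; congr (nat_of_bool _)%:R.
      apply/idP/idP; rewrite !inE /= !in_itv /=.
        by move=> [/andP[h1 h2] _]; apply/andP; split; lra.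
      by move=> /andP[h1 h2]; split => //; apply/andP; split; lra.
    rewrite integral_indic // setIT reduced_moment_itv ?lerD2r //.
    by congr EFin; rewrite /g; ring.
  rewrite integral0_eq // => x _; rewrite indicE.
  by rewrite memNset // => -[_ /= h]; move: yB; rewrite notin_setE; apply.
have gE : \int[@lebesgue_measure R]_(y in `[u, v]) g y =
  (q - p) * (v - u) + (Phi (p - u) - Phi (p - v)) - (Phi (q - u) - Phi (q - v)).
  rewrite /g RintegralD //; last exact: (integrable_bounded (cst (q - p)) `|q - p|).
    rewrite RintegralB // !(Rintegral_reflect _ K) // Rintegral_cst //=.
    rewrite lebesgue_measure_itv /= lte_fin; case: ltP => [_|vu] /=; first by ring.
    by have -> : u = v; [apply/eqP; rewrite eq_le uv|ring].
  exact: (integrableB _ (iF p) (iF q)).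
rewrite -gE /Rintegral fineK //.
apply: integrable_fin_num => //.
apply: (integrable_bounded g (K + K + `|q - p|)).
  by apply: measurable_funD => //; apply: measurable_funB.
move=> y; rewrite /g (le_trans (ler_normD _ _)) // lerD2r.
by rewrite (le_trans (ler_normB _ _)) // lerD.
Qed.

(** The first interval is made right-open, at the cost of a null event, so that [alpha2_itv]
    applies; the same null event closes it again in the diagonal term. *)
Lemma cnt_second_moment (p q u v : R) : p <= q -> u <= v ->
  (\int[P]_w (cnt eta `[p, q] w * cnt eta `[u, v] w)%:E =
   (@lebesgue_measure R) (`[p, q] `&` `[u, v]) +
   ((q - p) * (v - u) + (Phi (p - u) - Phi (p - v)) - (Phi (q - u) - Phi (q - v)))%:E)%E.
Proof.
move=> pq uv.
pose a := Num.min p u; pose b := Num.max q v.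
have pqab : `[p, q] `<=` `[a, b].
  move=> x /=; rewrite !in_itv /= ge_min le_max => /andP[-> ->] //.
have pqab' : `[p, q[ `<=` `[a, b].
  by move=> x /=; rewrite !in_itv /= ge_min le_max => /andP[-> /ltW ->].
have uvab : `[u, v] `<=` `[a, b].
  by move=> x /=; rewrite !in_itv /= ge_min le_max => /andP[-> ->]; rewrite !orbT.
have mc (W : set R) : measurable W -> measurable_fun [set: T] (fun w => (cnt eta W w)%:E).
  by move=> mW; apply/measurable_EFinP; exact: measurable_cnt.
transitivity (\int[P]_w (cnt eta `[p, q[ w * cnt eta `[u, v] w)%:E)%E.
  apply: ge0_ae_eq_integral => //.
  - by apply/measurable_EFinP; apply: measurable_funM; exact: measurable_cnt.
  - by apply/measurable_EFinP; apply: measurable_funM; exact: measurable_cnt.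
  - by move=> w _; rewrite lee_fin mulr_ge0 // cnt_ge0.
  - by move=> w _; rewrite lee_fin mulr_ge0 // cnt_ge0.
  apply: filterS (pts_itv_ae P eta pp p q ui pq) => w /= h _.
  by rewrite /cnt /npts h.
rewrite (integral_cnt_mul P eta pp _ _ a b) // alpha2_itv //; congr (_ + _)%E.
rewrite -(ui (_ `&` _)); last exact: measurableI.
rewrite -(ui (`[p, q] `&` _)); last exact: measurableI.
apply: ge0_ae_eq_integral => //.
- by case: pp => _; apply; exact: measurableI.
- by case: pp => _; apply; exact: measurableI.
apply: filterS (pts_itv_ae P eta pp p q ui pq) => w /= h _.
by rewrite /npts !setIA h.
Qed.
End moments.

(** * Variance and covariance in terms of [G] *)

(** The increment beyond [M0] is at most [e / 2 * n], and the fixed value [G M0] is eventually below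
    [e / 2 * n] as well. *)
Lemma vanishing_slope_div {R : realType} (G : R -> R) :
  vanishing_slope G -> G n%:R / n%:R @[n --> \oo] --> (0 : R).
Proof.
move=> sl; apply/cvgrPdist_le => e e0.
have e20 : 0 < e / 2 by rewrite divr_gt0.
have [M hM] := sl _ e20; pose M0 := Num.max M 0.
near=> n.
have n0 : 0 < n%:R :> R by near: n; exact: nbhs_infty_gtr.
have M0n : M0 <= n%:R by near: n; exact: nbhs_infty_ger.
have Gn : `|G M0| <= e / 2 * n%:R.
  by rewrite mulrC -ler_pdivrMr //; near: n; exact: nbhs_infty_ger.
rewrite sub0r normrN normrM normfV (gtr0_norm n0) ler_pdivrMr //.
have MM0 : M <= M0 by rewrite le_max lexx.
have h := hM _ _ MM0 M0n.
have -> : G n%:R = (G n%:R - G M0) + G M0 by rewrite subrK.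
apply: (le_trans (ler_normD _ _)).
have : e / 2 * (n%:R - M0) <= e / 2 * n%:R.
  by rewrite ler_pM2l // gerBl le_max lexx orbT.
rewrite [X in _ -> _ <= X * _](splitr e) mulrDl.
by move=> h2; apply: lerD => //; apply: le_trans h2.
Unshelve. all: by end_near. Qed.

(** By additivity, [n] times the defect [D x - D 1 * x] is the defect at [n x], which equals that of
    its fractional part. It is thus bounded uniformly in [n], so the defect is zero. *)
Lemma additive_lipschitz_linear {R : realType} (D : R -> R) (K : R) :
  (forall s y, 0 <= s -> 0 <= y -> D (s - y) = D s - D y) ->
  (forall x, 0 <= x -> `|D x| <= K * x) -> forall x, 0 <= x -> D x = D 1 * x.
Proof.
move=> DB DK x x0.
have Dn (n : nat) y : 0 <= y -> D (n%:R * y) = n%:R * D y.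
  move=> y0; elim: n => [|n IHn].
    by rewrite !mul0r; have := DB 0 0 (lexx 0) (lexx 0); rewrite !subrr.
  apply/eqP; rewrite -natr1 !mulrDl !mul1r -IHn -subr_eq -DB //.
    by rewrite addrK.
  by rewrite addr_ge0 // mulr_ge0.
have K0 : 0 <= K by have := DK 1 ler01; rewrite mulr1; exact: le_trans.
pose C := K + `|D 1|.
have bnd (n : nat) : n%:R * `|D x - D 1 * x| <= C.
  have nx0 : 0 <= n%:R * x by rewrite mulr_ge0.
  have /andP[m1 m2] := truncn_itv nx0; set m := Num.truncn _ in m1 m2.
  have Dm : D m%:R = m%:R * D 1 by rewrite -Dn ?mulr1.
  rewrite -[X in X * _](ger0_norm (ler0n _ n)) -normrM mulrBr -Dn //.
  have -> : D (n%:R * x) - n%:R * (D 1 * x) =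
     D (n%:R * x - m%:R * 1) - D 1 * (n%:R * x - m%:R).
    by rewrite mulr1 DB // Dm; ring.
  rewrite mulr1 (le_trans (ler_normB _ _)) //; apply: lerD.
    apply: (le_trans (DK _ _)); first by rewrite subr_ge0.
    by rewrite ler_piMr // lerBlDl natr1 ltW.
  rewrite normrM ler_piMr // ger0_norm ?subr_ge0 //.
  by rewrite lerBlDl natr1 ltW.
apply/eqP; rewrite -subr_eq0 -normr_eq0; apply/eqP/le_anti; rewrite normr_ge0 andbT.
rewrite leNgt; apply/negP => d0.
have C0 : 0 <= C by rewrite addr_ge0.
have /andP[_] := truncn_itv (divr_ge0 C0 (ltW d0)).
by rewrite ltr_pdivrMr // ltNge bnd.
Qed.

Section covariance.
Context {R : realType} {d : measure_display} {T : measurableType d}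
  (P : probability T R) (eta : T -> set R)
  (ar : {measure set R -> \bar R}) (beta : {charge set R -> \bar R}).
Hypothesis pp : point_process eta.
Hypothesis ui : unit_intensity P eta.
Hypothesis rs : reduced_second_moment P eta ar.
Hypothesis tp : truncated_pair_correlation ar beta.

Local Notation Phi := (primitive (Ffun beta)).

Lemma expectation_cnt (p q : R) : p <= q ->
  ('E_P[cnt eta `[p, q]] = (q - p)%:E)%E.
Proof.
move=> pq; rewrite unlock.
transitivity (\int[P]_w npts (eta w) `[p, q])%E.
  by apply: eq_integral => w _; rewrite (npts_cnt eta pp _ p q).
rewrite ui // lebesgue_measure_itv /= lte_fin; case: ltP => // qp.
by have -> : p = q; [apply/eqP; rewrite eq_le pq|rewrite subrr].
Qed.

Lemma integrable_ge0_fin (X : T -> R) (r : R) : measurable_fun [set: T] X ->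
  (forall w, 0 <= X w) -> (\int[P]_w (X w)%:E = r%:E)%E -> X \in Lfun P 1.
Proof.
move=> mX X0 Xr; apply/Lfun1_integrable/integrableP; split; first exact/measurable_EFinP.
under eq_integral do rewrite /= ger0_norm //.
by rewrite Xr ltry.
Qed.

Lemma lebesgue_measure_setI_itv (p q u v : R) :
  (@lebesgue_measure R) (`[p, q] `&` `[u, v]) =
  (Num.max 0 (Num.min q v - Num.max p u))%:E.
Proof.
have -> : `[p, q]%classic `&` `[u, v] = `[Num.max p u, Num.min q v]%classic.
  apply/seteqP; split => x /=; rewrite !in_itv /= ge_max le_min.
    by move=> [/andP[-> ->] /andP[-> ->]].
  by move=> /andP[/andP[-> ->] /andP[-> ->]].
rewrite lebesgue_measure_itv /= lte_fin -EFinB.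
have [h|h] := ltP (Num.max p u) (Num.min q v); congr EFin; apply/esym.
  by apply/max_idPr; rewrite subr_ge0 ltW.
by apply/max_idPl; rewrite subr_le0.
Qed.

(** The term [(q - p) * (v - u)] of the second moment is the product of the means and cancels; the
    maximum is the length of the overlap. *)
Lemma covariance_cnt (p q u v : R) : p <= q -> u <= v ->
  covariance P (cnt eta `[p, q]) (cnt eta `[u, v]) =
  (Num.max 0 (Num.min q v - Num.max p u) +
   ((Phi (p - u) - Phi (p - v)) - (Phi (q - u) - Phi (q - v))))%:E.
Proof.
move=> pq uv.
have L1 (a b : R) : a <= b -> cnt eta `[a, b] \in Lfun P 1.
  move=> ab; apply: (integrable_ge0_fin _ (b - a)); first exact: measurable_cnt.
    by move=> w; exact: cnt_ge0.
  by rewrite -expectation_cnt // unlock.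
have := cnt_second_moment P eta ar beta pp ui rs tp p q u v pq uv.
rewrite lebesgue_measure_setI_itv -EFinD => E2.
have L2 : (cnt eta `[p, q] * cnt eta `[u, v])%R \in Lfun P 1.
  apply: (integrable_ge0_fin _ _ _ _ E2).
    by apply: measurable_funM; exact: measurable_cnt.
  by move=> w; rewrite mulr_ge0 // cnt_ge0.
rewrite covarianceE ?L1 // !expectation_cnt // unlock [X in (X - _)%E]E2.
by rewrite -EFinM -EFinB; congr EFin; ring.
Qed.

Lemma primitive0 : Phi 0 = 0.
Proof. by rewrite /primitive subrr. Qed.

(** Equate the covariance of the counts of [[0, s]] and [[0, y]] with the one taken in the other
    order; the overlap is symmetric and drops out. *)
Lemma primitive_additive (s y : R) : 0 <= s -> 0 <= y ->
  Phi (s - y) - Phi (- (s - y)) = (Phi s - Phi (- s)) - (Phi y - Phi (- y)).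
Proof.
move=> s0 y0.
have -> : - (s - y) = y - s by ring.
have := covarianceC P (cnt eta `[0, s]) (cnt eta `[0, y]).
rewrite (covariance_cnt 0 s 0 y s0 y0) (covariance_cnt 0 y 0 s y0 s0) (minC y s).
move=> [] /addrI; rewrite (subr0 0) !sub0r !subr0 primitive0.
move: (Phi _) (Phi _) (Phi _) (Phi _) (Phi _) (Phi _) => *; lra.
Qed.

Lemma Gfun_primitive (y : R) : 0 <= y -> Gfun beta y = - Phi y.
Proof.
by move=> y0; rewrite /Gfun /primitive (Rintegral_itv_deg _ y 0) // subr0.
Qed.

Lemma primitive_slope : vanishing_slope Phi.
Proof.
move=> e /(Ffun_vanish beta)[M hM]; exists M => x y Mx xy.
have [K FK] := Ffun_bounded beta.
have mF := measurable_Ffun beta.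
have Fe t : x <= t -> - e <= Ffun beta t <= e.
  by move=> xt; rewrite -ler_norml; apply: hM; apply: le_trans xt.
rewrite ler_norml -mulNr (primitive_le _ K) ?(primitive_ge _ K) // => t /Fe /andP[] //.
Qed.

Lemma primitive_lipschitz : exists K, forall x, 0 <= x -> `|Phi x - Phi (- x)| <= K * x.
Proof.
have [K FK] := Ffun_bounded beta.
have mF := measurable_Ffun beta.
exists (2 * K) => x x0; have -> : 2 * K * x = K * (x - - x) by ring.
have xx : - x <= x by lra.
have FKt t : - K <= Ffun beta t <= K by rewrite -ler_norml.
rewrite ler_norml -mulNr (primitive_le _ K) ?(primitive_ge _ K) // => t _.
  by case/andP: (FKt t).
by case/andP: (FKt t).
Qed.

Lemma variance_cnt (y : R) : 0 <= y ->
  'V_P[cnt eta (Lam 0 y)]%E = (y - Phi (- y) - Phi y)%:E.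
Proof.
move=> y0; rewrite /variance /Lam add0r covariance_cnt //; congr EFin.
rewrite minxx maxxx !subr0 subrr !sub0r primitive0 (max_idPr y0).
by move: (Phi _) (Phi _) => *; ring.
Qed.

Hypothesis hu : hyperuniform P eta.

(** Integrated form of [F x + F (- x) = -1], which expresses the symmetry of [beta] together with
    total mass -1. *)
Lemma primitiveN (x : R) : 0 <= x -> Phi (- x) = Phi x + x.
Proof.
pose D x := Phi x - Phi (- x).
have [K DK] := primitive_lipschitz.
have Dlin := additive_lipschitz_linear D K primitive_additive DK.
suff D1 : D 1 = -1.
  by move=> x0; have := Dlin x x0; rewrite D1 /D; lra.
(* The variance divided by [n] is [1 + D 1 - 2 * (Phi n / n)], whose last term vanishes;
   hyperuniformity then forces [1 + D 1 = 0]. *)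
have h : fine 'V_P[cnt eta (Lam 0 n%:R)]%E / n%:R @[n --> \oo] --> 1 + D 1 - 2 * 0.
  have h : 1 + D 1 - 2 * (Phi n%:R / n%:R) @[n --> \oo] --> 1 + D 1 - 2 * 0.
    apply: cvgB; first exact: cvg_cst.
    by apply: cvgM; [exact: cvg_cst|exact: vanishing_slope_div primitive_slope].
  apply: cvg_near_eq h; near=> n.
  have n0 : 0 < n%:R :> R by near: n; exact: nbhs_infty_gtr.
  rewrite /= variance_cnt //=.
  have -> : Phi (- n%:R) = Phi n%:R - D 1 * n%:R by rewrite -Dlin // /D; ring.
  by field; rewrite gt_eqF.
have : 0 = 1 + D 1 - 2 * 0 by exact: cvg_unique hu h.
lra.
Unshelve. all: by end_near. Qed.

Lemma variance_Gfun (y : R) : 0 <= y ->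
  'V_P[cnt eta (Lam 0 y)]%E = (2 * Gfun beta y)%:E.
Proof.
move=> y0; rewrite variance_cnt // primitiveN // Gfun_primitive //.
by congr EFin; ring.
Qed.

Lemma covariance_Gfun (n m : R) : 0 <= n ->
  covariance P (cnt eta (Lam 0 n)) (cnt eta (Lam m n)) =
  (Gfun beta `|m + n| + Gfun beta `|m - n| - 2 * Gfun beta `|m|)%:E.
Proof.
move=> n0; rewrite /Lam add0r covariance_cnt ?lerDl // !Gfun_primitive ?normr_ge0 //.
(* One formula for both signs, so that no case split on the order of [m] and [n] is needed. *)
have PhiE x : Phi (- x) = Phi `|x| + Num.max 0 x.
  have [x0|x0] := leP 0 x; first by rewrite ger0_norm // primitiveN // (max_idPr _).
  by rewrite ltr0_norm // addr0.
congr EFin; rewrite !sub0r.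
have -> : n - (m + n) = - m by ring.
rewrite -(opprB m n) !PhiE.
(* The overlap of the two windows is a second difference of the positive part, and cancels the terms
   [Num.max 0 x] coming from [PhiE]. *)
have -> : Num.max 0 (Num.min n (m + n) - Num.max 0 m) =
   Num.max 0 (m + n) + Num.max 0 (m - n) - 2 * Num.max 0 m.
  rewrite /Num.min /Num.max; do ! case: ifP; lra.
ring.
Qed.

(** The mean [n + 1/2] is at distance at least 1/2 from every integer, so the squared deviation is
    at least 1/4 pointwise; [G] is half the variance. *)
Lemma Gfun_half_ge (n : nat) : 1 / 8 <= Gfun beta (n%:R + 1 / 2).
Proof.
have y0 : 0 <= n%:R + 1 / 2 :> R by rewrite addr_ge0 // divr_ge0.
suff : ((1 / 4)%:E <= 'V_P[cnt eta (Lam 0 (n%:R + 1 / 2))])%E.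
  by rewrite variance_Gfun // lee_fin; lra.
rewrite /variance /Lam add0r unlock expectation_cnt // subr0 /= unlock.
apply: (@le_trans _ _ (\int[P]_w (1 / 4)%:E)%E).
  by rewrite integral_cst //= probability_setT mule1.
apply: ge0_le_integral => //.
  apply/measurable_EFinP; apply: measurable_funM; apply: measurable_funB => //;
  exact: measurable_cnt.
move=> w _; rewrite lee_fin.
have [k hk] := cnt_nat eta pp `[0, n%:R + 1 / 2] 0 (n%:R + 1 / 2) w (@subset_refl _ _).
rewrite [leRHS](_ : _ = (k%:R - (n%:R + 1 / 2)) ^+ 2); last by rewrite -hk expr2.
have [kn|nk] := leqP k n.
  have : k%:R <= n%:R :> R by rewrite ler_nat.
  by move=> ?; nra.
have : n%:R + 1 <= k%:R :> R by rewrite natr1 ler_nat.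
by move=> ?; nra.
Qed.

End covariance.

(** * Limits of the covariance ratios *)

Lemma cov_profile1 {R : realType} (a : R) : cov_profile a 1 = 2 `^ (a - 1) - 1.
Proof.
have -> : 2 `^ (a - 1) = 2 `^ a / 2 :> R.
  by rewrite powRB ?pnatr_eq0 ?implybT // powRr1.
rewrite /cov_profile subrr normr0; have -> : `|1 + 1| = 2 :> R by rewrite ger0_norm.
rewrite oner_eq0 eqxx normr1 powR1; have [->|a0] := eqVneq a 0.
  by rewrite /= powRr0; lra.
by rewrite powR0 // mul0r add0r.
Qed.

Lemma powR2_inj {R : realType} (x y : R) : 2 `^ x = 2 `^ y -> x = y.
Proof.
have l2 : 0 < ln 2 :> R by apply: ln_gt0; rewrite ltr1n.
rewrite /powR pnatr_eq0 /= => /expR_inj; apply: mulIf; exact: lt0r_neq0.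
Qed.

Section limits.
Context {R : realType} {d : measure_display} {T : measurableType d}
  (P : probability T R) (eta : T -> set R)
  (ar : {measure set R -> \bar R}) (beta : {charge set R -> \bar R}).
Hypothesis pp : point_process eta.
Hypothesis ui : unit_intensity P eta.
Hypothesis rs : reduced_second_moment P eta ar.
Hypothesis tp : truncated_pair_correlation ar beta.
Hypothesis hu : hyperuniform P eta.

Local Notation G := (Gfun beta).

Lemma Gfun0 : G 0 = 0.
Proof. by rewrite Gfun_primitive // primitive0 oppr0. Qed.

Lemma fine_variance (n : nat) : fine 'V_P[cnt eta (Lam 0 n%:R)]%E = 2 * G n%:R.
Proof. by rewrite (variance_Gfun P eta ar beta) //= ler0n. Qed.

Lemma cov_ratioE (z : R) (n : nat) :
  cov_ratio P eta z n =
  G (`|z + 1| * n%:R) / G n%:R / 2 + G (`|z - 1| * n%:R) / G n%:R / 2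
  - G (`|z| * n%:R) / G n%:R.
Proof.
rewrite /cov_ratio fine_variance.
rewrite (covariance_Gfun P eta ar beta pp ui rs tp hu _ _ (ler0n R n)) /=.
have nE x : `|x| * n%:R = `|x * n%:R| by rewrite normrM (ger0_norm (ler0n _ n)).
rewrite !nE; have -> : (z + 1) * n%:R = n%:R * z + n%:R by ring.
have -> : (z - 1) * n%:R = n%:R * z - n%:R by ring.
rewrite (mulrC z) invfM.
(* The inverse is generalised as well, so the identity also covers [G n%:R = 0]. *)
by move: (G _) (G _) (G _) (G _)^-1 => *; field.
Qed.

(** At [c = 0] the ratio is 0 because [G 0 = 0], whereas [powR] takes the value 1 at [0] with
    exponent [0]; hence the case distinction. *)
Lemma Gfun_ratio (a c : R) : regularly_varying G a -> 0 <= c ->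
  G (c * n%:R) / G n%:R @[n --> \oo] --> (if c == 0 then 0 else c `^ a).
Proof.
move=> [_ rv]; rewrite le_eqVlt => /predU1P[<-|c0]; last by rewrite gt_eqF //; exact: rv.
rewrite eqxx (_ : (fun n => _) = cst 0); first exact: cvg_cst.
by apply/funext => n; rewrite mul0r Gfun0 mul0r.
Qed.

Lemma cov_limit_of_regularly_varying (a z : R) :
  regularly_varying G a -> cov_limit P eta z (cov_profile a z).
Proof.
move=> rv; split.
  by apply: filterS rv.1 => n Gn; rewrite fine_variance mulf_neq0.
rewrite (_ : cov_ratio P eta z = (fun n : nat => G (`|z + 1| * n%:R) / G n%:R / 2 +
   G (`|z - 1| * n%:R) / G n%:R / 2 - G (`|z| * n%:R) / G n%:R)); last first.
  by apply/funext => n; exact: cov_ratioE.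
(* For [a = 0] this is the indicator of [c != 0], which produces the exceptional points -1, 0 and 1
   of the profile. *)
pose psi c : R := if c == 0 then 0 else c `^ a.
have -> : cov_profile a z = psi `|z + 1| / 2 + psi `|z - 1| / 2 - psi `|z|.
  rewrite /cov_profile /psi !normr_eq0; have [->|a0] := eqVneq a 0.
    rewrite !powRr0 addr_eq0 subr_eq0.
    have [->|z0] := eqVneq z 0; first by rewrite !(eq_sym 0) oppr_eq0 oner_eq0; lra.
    have [->|z1] := eqVneq z 1.
      have -> : (1 == -1 :> R) = false by apply/eqP; lra.
      by rewrite /=; lra.
    by case: (eqVneq z (-1)) => _ /=; lra.
  have psiE x : (if x == 0 then 0 else `|x| `^ a) = `|x| `^ a.
    by case: eqVneq => // ->; rewrite normr0 powR0.
  by rewrite !psiE [in RHS]addrC addrA [in RHS]addrC; lra.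
apply: cvgB; last exact: Gfun_ratio.
by apply: cvgD; apply: cvgMl; apply: Gfun_ratio.
Qed.

(** * From limits of covariance ratios back to regular variation *)

Lemma Gfun_slope : vanishing_slope G.
Proof.
move=> e /(primitive_slope beta)[M hM]; exists (Num.max 0 M) => x y.
rewrite ge_max => /andP[x0 Mx] xy.
rewrite !Gfun_primitive ?(le_trans x0) // -opprD normrN; exact: hM.
Qed.

Lemma Gfun_nondecreasing (M : R) : (forall x, M <= x -> Ffun beta x <= 0) ->
  ev_nondecreasing G.
Proof.
move=> F0; exists (Num.max 0 M) => x y; rewrite ge_max => /andP[x0 Mx] xy.
have [K FK] := Ffun_bounded beta.
rewrite !Gfun_primitive ?(le_trans x0) // lerN2 -subr_le0 -(mul0r (y - x)).
apply: (primitive_le _ K) => //; first exact: measurable_Ffun.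
by move=> t xt; apply: F0; apply: le_trans xt.
Qed.

Lemma Gfun_nonincreasing (M : R) : (forall x, M <= x -> 0 <= Ffun beta x) ->
  ev_nondecreasing (\- G).
Proof.
move=> F0; exists (Num.max 0 M) => x y; rewrite ge_max => /andP[x0 Mx] xy.
have [K FK] := Ffun_bounded beta.
rewrite /= !Gfun_primitive ?(le_trans x0) // !opprK -subr_ge0 -(mul0r (y - x)).
apply: (primitive_ge _ K) => //; first exact: measurable_Ffun.
by move=> t xt; apply: F0; apply: le_trans xt.
Qed.

Lemma half_point_ge (x : R) : exists n : nat, x <= n%:R + 1 / 2.
Proof.
exists (Num.truncn (Num.max 0 x)).+1.
have /truncn_itv /andP[_ h] : 0 <= Num.max 0 x by rewrite le_max lexx.
have xm : x <= Num.max 0 x by rewrite le_max lexx orbT.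
lra.
Qed.

Lemma Gfun_ge_of_nondecreasing :
  ev_nondecreasing G -> \forall x \near +oo, 1 / 8 <= G x.
Proof.
move=> [M Gnd]; have [n Mn] := half_point_ge M; near=> x.
have xn : n%:R + 1 / 2 <= x by near: x; exact: near_pinfty_ge.
apply: le_trans (Gfun_half_ge P eta ar beta pp ui rs tp hu n) _.
exact: Gnd Mn xn.
Unshelve. all: by end_near. Qed.

(** Here the lower bound is carried back to [x] from a half-integer beyond [x], rather than forward
    from a fixed one. *)
Lemma Gfun_ge_of_nonincreasing :
  ev_nondecreasing (\- G) -> \forall x \near +oo, 1 / 8 <= G x.
Proof.
move=> [M Gni]; near=> x; have [n xn] := half_point_ge x.
have Mx : M <= x by near: x; exact: near_pinfty_ge.
apply: le_trans (Gfun_half_ge P eta ar beta pp ui rs tp hu n) _.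
by rewrite -lerN2; exact: Gni Mx xn.
Unshelve. all: by end_near. Qed.

(** At [z = 1] the term in [|z - 1|] vanishes, and the covariance ratio is
    [G (2 n) / (2 G n) - 1]. *)
Lemma Gfun_ratio2 (l1 : R) : cov_limit P eta 1 l1 ->
  G (2 * n%:R) / G n%:R @[n --> \oo] --> 2 * l1 + 2.
Proof.
move=> [Vn0 c1].
have h : 2 * cov_ratio P eta 1 n + 2 @[n --> \oo] --> 2 * l1 + 2.
  by apply: cvgD; [apply: cvgMr|exact: cvg_cst].
apply: cvg_near_eq h; near=> n.
have Gn : G n%:R != 0.
  have : fine 'V_P[cnt eta (Lam 0 n%:R)]%E != 0 by near: n.
  by rewrite fine_variance mulf_eq0 negb_or => /andP[].
rewrite cov_ratioE subrr normr0 mul0r Gfun0 normr1 mul1r (ger0_norm (_ : 0 <= 1 + 1)) //.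
by field.
Unshelve. all: by end_near. Qed.

(** At [z = 2] the ratio is [G (3 n) / (2 G n) + 1/2 - G (2 n) / G n], whose last term is known from
    [z = 1]. *)
Lemma Gfun_ratio3 (l1 l2 : R) : cov_limit P eta 1 l1 -> cov_limit P eta 2 l2 ->
  G (3 * n%:R) / G n%:R @[n --> \oo] --> 2 * l2 - 1 + 2 * (2 * l1 + 2).
Proof.
move=> cl1 [Vn0 c2].
have h : 2 * cov_ratio P eta 2 n - 1 + 2 * (G (2 * n%:R) / G n%:R)
    @[n --> \oo] --> 2 * l2 - 1 + 2 * (2 * l1 + 2).
  apply: cvgD; last by apply: cvgMr; exact: Gfun_ratio2.
  by apply: cvgB; [apply: cvgMr|exact: cvg_cst].
apply: cvg_near_eq h; near=> n.
have Gn : G n%:R != 0.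
  have : fine 'V_P[cnt eta (Lam 0 n%:R)]%E != 0 by near: n.
  by rewrite fine_variance mulf_eq0 negb_or => /andP[].
rewrite cov_ratioE; have -> : `|2 + 1| = 3 :> R by rewrite ger0_norm; lra.
have -> : `|2 - 1| = 1 :> R by rewrite ger0_norm; lra.
rewrite mul1r (ger0_norm (_ : 0 <= 2)) //.
by field.
Unshelve. all: by end_near. Qed.

Lemma regularly_varying_of_cov_limits (l1 l2 : R) :
  (exists M : R, forall x, M <= x -> Ffun beta x <= 0) \/
  (exists M : R, forall x, M <= x -> 0 <= Ffun beta x) ->
  cov_limit P eta 1 l1 -> cov_limit P eta 2 l2 ->
  exists a : R, 0 <= a <= 1 /\ regularly_varying G a.
Proof.
have c0 : 0 < 1 / 8 :> R by lra.
move=> [[M /Gfun_nondecreasing Gnd]|[M /Gfun_nonincreasing Gni]] cl1 cl2.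
  apply: (regularly_varying_of_nondecreasing G _ _ _ Gnd Gfun_slope c0).
  - exact: Gfun_ge_of_nondecreasing.
  - exact: vanishing_slope_div Gfun_slope.
  - exact: Gfun_ratio2 cl1.
  - exact: Gfun_ratio3 cl1 cl2.
exists 0; rewrite lexx ler01; split => //.
exact: regularly_varying_of_nonincreasing Gni c0 (Gfun_ge_of_nonincreasing Gni).
Qed.

(** The limits at 1 and 2 yield regular variation of some index [b]; comparing the two values
    [2 ^ (a - 1) - 1] and [2 ^ (b - 1) - 1] of the limit at 1 identifies [b] with [a]. *)
Lemma regularly_varying_of_cov_profile (a : R) :
  (exists M : R, forall x, M <= x -> Ffun beta x <= 0) \/
  (exists M : R, forall x, M <= x -> 0 <= Ffun beta x) ->
  (forall z : R, cov_limit P eta z (cov_profile a z)) -> regularly_varying G a.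
Proof.
move=> sgn cl.
have [b [_ rv]] := regularly_varying_of_cov_limits _ _ sgn (cl 1) (cl 2).
suff -> : a = b by [].
have : cov_profile a 1 = cov_profile b 1.
  exact: cvg_unique (cl 1).2 (cov_limit_of_regularly_varying b 1 rv).2.
rewrite !cov_profile1 => /addIr /powR2_inj /addIr //.
Qed.

End limits.

Theorem theorem2 (R : realType) (d : measure_display) (T : measurableType d)
  (P : probability T R) (eta : T -> set R)
  (ar : {measure set R -> \bar R}) (beta : {charge set R -> \bar R}) :
  point_process eta -> stationary P eta -> unit_intensity P eta ->
  reduced_second_moment P eta ar -> truncated_pair_correlation ar beta ->
  hyperuniform P eta ->
  (* G(y) = Var(eta(Lambda_y)) / 2 *)
  (forall y : R, 0 < y ->
     (Gfun beta y)%:E = ('V_P[cnt eta (Lam 0 y)] * (2^-1)%:E)%E) /\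
  (* (i) => (ii), and cov(1) = 2^(a-1) - 1 *)
  (forall a : R, 0 <= a <= 1 -> regularly_varying (Gfun beta) a ->
     (forall z : R, cov_limit P eta z (cov_profile a z)) /\
     cov_limit P eta 1 (2 `^ (a - 1) - 1)) /\
  (* under an eventual sign condition on F: (i) <=> (ii) <=> (iii) *)
  ((exists M : R, forall x, M <= x -> Ffun beta x <= 0) \/
   (exists M : R, forall x, M <= x -> 0 <= Ffun beta x) ->
     (forall a : R, 0 <= a <= 1 ->
        (regularly_varying (Gfun beta) a <->
         (forall z : R, cov_limit P eta z (cov_profile a z)))) /\
     ((exists l1 l2 : R, cov_limit P eta 1 l1 /\ cov_limit P eta 2 l2) <->
      (exists a : R, 0 <= a <= 1 /\ regularly_varying (Gfun beta) a)) /\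
     (forall a : R, 0 <= a <= 1 ->
        (forall z : R, cov_limit P eta z (cov_profile a z)) ->
        cov_limit P eta 1 (2 `^ (a - 1) - 1)) /\
     ((exists l1 l2 : R, cov_limit P eta 1 l1 /\ cov_limit P eta 2 l2) ->
      exists a : R, 0 <= a <= 1 /\ regularly_varying (Gfun beta) a /\
        cov_limit P eta 1 (2 `^ (a - 1) - 1))).
Proof.
move=> pp _ ui rs tp hu.
have lim a z : regularly_varying (Gfun beta) a -> cov_limit P eta z (cov_profile a z).
  exact: (cov_limit_of_regularly_varying P eta ar beta).
split; [|split; [|move=> sgn]].
- move=> y /ltW y0; rewrite (variance_Gfun P eta ar beta) // -EFinM.
  by congr EFin; field.
- by move=> a _ rv; rewrite -cov_profile1; split => [z|]; exact: lim.
have rvP l1 l2 : cov_limit P eta 1 l1 -> cov_limit P eta 2 l2 ->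
    exists a : R, 0 <= a <= 1 /\ regularly_varying (Gfun beta) a.
  exact: (regularly_varying_of_cov_limits P eta ar beta).
split=> [a _|]; last split; last split.
- split=> [rv z|]; first exact: lim.
  exact: (regularly_varying_of_cov_profile P eta ar beta).
- split=> [[l1 [l2 [c1 c2]]]|[a [_ rv]]]; first exact: rvP c1 c2.
  by exists (cov_profile a 1), (cov_profile a 2); split; exact: lim.
- by move=> a _; rewrite -cov_profile1; apply.
- move=> [l1 [l2 [c1 c2]]]; have [a [a01 rv]] := rvP _ _ c1 c2.
  by exists a; rewrite -cov_profile1; split => //; split => //; exact: lim.
Qed.
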